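(* Let $E$ be a Banach space such that $\mathcal{A}(E)$ has a left approximate identity. Then the following are equivalent: (a) the Banach algebra $\mathcal{A}(E)$ is topologically left Noetherian; (b) every closed left ideal of $\mathcal{A}(E)$ is topologically principal; (c) the dual space $E'$ is separable.
   Context: $\mathcal{A}(E)$ is the Banach algebra of approximable operators on $E$, i.e. the operator-norm closure of the bounded finite-rank operators on $E$. A left approximate identity of a Banach algebra $A$ is a (not necessarily bounded) net $(e_\alpha)$ in $A$ with $e_\alpha a\to a$ in norm for every $a\in A$. $A^\sharp$ denotes the (conditional) unitisation of $A$: $A^\sharp=A$ if $A$ is unital, and $A^\sharp$ is $A$ with an identity adjoined otherwise. A closed left ideal $I$ of $A$ is topologically finitely-generated if there exist $n\in\mathbb{N}$ and $x_1,\ldots,x_n\in I$ with $I=\overline{A^\sharp x_1+\cdots+A^\sharp x_n}$ (norm closure), and topologically principal if $I=\overline{A^\sharp x}$ for some $x\in I$. $A$ is topologically left Noetherian if every closed left ideal of $A$ is topologically finitely-generated. *)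

(* Defs.v *)
From HB Require Import structures.
From mathcomp Require Import all_boot all_order all_algebra.
From mathcomp Require Import all_classical all_reals all_analysis.
From mathcomp Require Export complex.

Set Implicit Arguments.
Unset Strict Implicit.
Unset Printing Implicit Defensive.

Import Order.TTheory GRing.Theory Num.Theory.
Import numFieldNormedType.Exports.

Local Open Scope classical_set_scope.
Local Open Scope ring_scope.

(* Indexed, so that a case analysis on [real_or_complex R K] replaces the
   scalar field K by R or by R[i], together with its order and norm. *)
Inductive real_or_complex (R : realType) : numFieldType -> Prop :=
| RealScalars : real_or_complex R (R : numFieldType)
| ComplexScalars : real_or_complex R (R[i] : numFieldType).

Section BoundedOperators.
Variables (K : numFieldType).
Implicit Types (E F G : normedModType K).

(* c bounds the operator norm of f: the operator norm is the infimum of all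
   such c. *)
Definition norm_bound E F (f : E -> F) (c : K) : Prop :=
  0 <= c /\ forall x, `|f x| <= c * `|x|.

Definition bounded_linear E F : pred (E -> F) :=
  fun f => `[< linear f /\ exists c, norm_bound f c >].

Record bop E F := Bop { bop_fun :> E -> F; _ : bop_fun \in @bounded_linear E F }.

HB.instance Definition _ E F := [isSub for @bop_fun E F].
HB.instance Definition _ E F := [Choice of bop E F by <:].

Lemma bounded_linear_submod E F : submod_closed (@bounded_linear E F).
Proof.
split.
  apply/asboolP; split; first by move=> a x y; rewrite scaler0 addr0.
  by exists 0; split=> // x; rewrite normr0 mul0r.
move=> a f g /asboolP[lf [c [c0 fc]]] /asboolP[lg [d [d0 gd]]].
apply/asboolP; split.
  move=> b x y; rewrite !fctE lf lg !scalerDr !scalerA (mulrC a b).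
  by rewrite addrACA.
exists (`|a| * c + d); split; first by rewrite addr_ge0 ?mulr_ge0.
move=> x; rewrite !fctE (le_trans (ler_normD _ _))// mulrDl lerD//.
by rewrite normrZ -mulrA ler_wpM2l.
Qed.

HB.instance Definition _ E F :=
  GRing.isSubmodClosed.Build K (E -> F) (@bounded_linear E F)
    (@bounded_linear_submod E F).
HB.instance Definition _ E F := [SubChoice_isSubLmodule of bop E F by <:].

Lemma bopP E F (T : bop E F) : linear T /\ exists c, norm_bound T c.
Proof. by case: T => f /= /asboolP. Qed.

Lemma bopDE E F (S T : bop E F) x : (S + T) x = S x + T x.
Proof. by []. Qed.

Lemma bopBE E F (S T : bop E F) x : (S - T) x = S x - T x.
Proof. by []. Qed.

Lemma bopZE E F (a : K) (T : bop E F) x : (a *: T) x = a *: T x.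
Proof. by []. Qed.

Lemma bop_id_subproof E : (@id E) \in @bounded_linear E E.
Proof.
by apply/asboolP; split=> //; exists 1; split=> // x; rewrite mul1r.
Qed.

Lemma bop_comp_subproof E F G (S : bop F G) (T : bop E F) :
  (S \o T) \in @bounded_linear E G.
Proof.
have [lS [c [c0 Sc]]] := bopP S; have [lT [d [d0 Td]]] := bopP T.
apply/asboolP; split; first by move=> a x y; rewrite /= lT lS.
exists (c * d); split; first exact: mulr_ge0.
by move=> x; rewrite /= (le_trans (Sc _))// -mulrA ler_wpM2l.
Qed.

Definition bop_id E : bop E E := Bop (@bop_id_subproof E).
Definition bop_comp E F G (S : bop F G) (T : bop E F) : bop E G :=
  Bop (bop_comp_subproof S T).

Lemma bop_compA E : associative (@bop_comp E E E).
Proof. by move=> S T U; apply/val_inj. Qed.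
Lemma bop_comp1l E : left_id (bop_id E) (@bop_comp E E E).
Proof. by move=> S; apply/val_inj. Qed.
Lemma bop_comp1r E : right_id (bop_id E) (@bop_comp E E E).
Proof. by move=> S; apply/val_inj. Qed.
Lemma bop_compDl E : left_distributive (@bop_comp E E E) +%R.
Proof. by move=> S T U; apply/val_inj. Qed.
Lemma bop_compDr E : right_distributive (@bop_comp E E E) +%R.
Proof.
move=> S T U; apply/val_inj/funext => x /=.
have [lS _] := bopP S.
by have := lS 1 (T x) (U x); rewrite !scale1r.
Qed.

HB.instance Definition _ E := GRing.Zmodule_isPzRing.Build (bop E E)
  (@bop_compA E) (@bop_comp1l E) (@bop_comp1r E)
  (@bop_compDl E) (@bop_compDr E).

(* The open ball of radius e for the operator norm. The condition says that
   the infimum of the bounds of S - T is smaller than e; in this form it needs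
   no completeness of the ordered field K. *)
Definition bop_ball E F (S : bop E F) (e : K) (T : bop E F) : Prop :=
  exists2 c, norm_bound (S - T) c & c < e.

Lemma bop_ball_center E F (S : bop E F) (e : K) : 0 < e -> bop_ball S e S.
Proof.
move=> e0; exists 0 => //; split=> // x.
by rewrite bopBE subrr normr0 mul0r.
Qed.

Lemma bop_ball_sym E F (S T : bop E F) (e : K) :
  bop_ball S e T -> bop_ball T e S.
Proof.
move=> [c [c0 Hc] ce]; exists c => //; split=> // x.
by rewrite bopBE distrC -bopBE.
Qed.

Lemma bop_ball_triangle E F (S T U : bop E F) (e1 e2 : K) :
  bop_ball S e1 T -> bop_ball T e2 U -> bop_ball S (e1 + e2) U.
Proof.
move=> [c [c0 Hc] ce] [d [d0 Hd] de]; exists (c + d); last exact: ltrD.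
split; first exact: addr_ge0.
move=> x; rewrite bopBE (le_trans (ler_distD (T x) _ _))// mulrDl.
by rewrite lerD// -bopBE.
Qed.

HB.instance Definition _ E F :=
  hasNbhs.Build (bop E F) (nbhs_ (entourage_ (@bop_ball E F))).
HB.instance Definition _ E F := Nbhs_isPseudoMetric.Build K (bop E F)
  erefl (@bop_ball_center E F) (@bop_ball_sym E F) (@bop_ball_triangle E F)
  erefl.

Definition dual E := bop E K^o.

Definition separable_space (T : topologicalType) : Prop :=
  exists D : set T, countable D /\ dense D.

Definition finite_rank E F : set (bop E F) :=
  [set T | exists (n : nat) (v : 'I_n -> F),
     forall x, exists c : 'I_n -> K, T x = \sum_(i < n) c i *: v i].

Definition approximable E : set (bop E E) := closure (@finite_rank E E).

End BoundedOperators.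

(* The notions below concern a Banach algebra A realised as a norm-closed
   subalgebra of the bounded operators on E; * is composition and 1 is the
   identity operator. *)
Section OperatorAlgebras.
Variables (K : numFieldType) (E : normedModType K).
Implicit Types (A I : set (bop E E)).

Definition directed (D : Type) (le : D -> D -> Prop) : Prop :=
  [/\ inhabited D, (forall d, le d d),
      (forall d1 d2 d3, le d1 d2 -> le d2 d3 -> le d1 d3) &
      (forall d1 d2, exists2 d, le d1 d & le d2 d)].

Definition net_tails (D : Type) (le : D -> D -> Prop) : set_system D :=
  filter_from setT (fun d => [set d' | le d d']).

Definition has_left_approximate_identity A : Prop :=
  exists (D : Type) (le : D -> D -> Prop) (e : D -> bop E E),
    [/\ directed le, (forall d, A (e d)) &
        forall a, A a -> e d * a @[d --> net_tails le] --> a].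

Definition unital A : Prop :=
  exists2 u, A u & forall a, A a -> u * a = a /\ a * u = a.

(* If A has no identity of its own, then 1 is not in A, so that the sum of A
   and K1 is direct and is A with an identity adjoined. *)
Definition unitisation A : set (bop E E) :=
  [set b | A b \/
     ~ unital A /\ exists (a : bop E E) (k : K), A a /\ b = a + k *: (1 : bop E E)].

Definition left_ideal A I : Prop :=
  [/\ I `<=` A, I 0, (forall x y, I x -> I y -> I (x + y)),
      (forall (k : K) x, I x -> I (k *: x)) &
      (forall a x, A a -> I x -> I (a * x))].

(* As A is closed, being closed in A is the same as being closed. *)
Definition closed_left_ideal A I : Prop := left_ideal A I /\ closed I.

Definition generated A n (x : 'I_n -> bop E E) : set (bop E E) :=
  [set y | exists2 b : 'I_n -> bop E E,
     (forall i, unitisation A (b i)) & y = \sum_(i < n) b i * x i].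

Definition topologically_finitely_generated A I : Prop :=
  exists (n : nat) (x : 'I_n -> bop E E),
    (forall i, I (x i)) /\ I = closure (generated A x).

Definition topologically_principal A I : Prop :=
  exists2 x, I x & I = closure [set b * x | b in unitisation A].

Definition topologically_left_noetherian A : Prop :=
  forall I, closed_left_ideal A I -> topologically_finitely_generated A I.

End OperatorAlgebras.

(* Main.v *)
(* The row space of a closed left ideal I of A(E) is the closed subspace of E'
   of the functionals f such that I contains every rank-one operator v (x) f.
   If A(E) has a left approximate identity, then every T in I is a limit of
   operators S T with S of finite rank, and each of these is a sum of rank-one
   operators v (x) f with f in the row space; hence I is determined by its row
   space.

   If E' is separable, Gram-Schmidt applied to a dense sequence of the row
   space gives a biorthogonal system (x_n, g_n) whose functionals span a dense
   subspace of it.  For c_n > 0 decreasing fast enough, T = sum_n c_n x_n (x) g_n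
   lies in I, and (v (x) g_m) T = c_m (v (x) g_m), so that T generates I.  The
   vectors are chosen after the functionals, and no Hahn-Banach extension is
   needed.

   Conversely let x_1, ..., x_n generate A(E) topologically, and fix a
   functional nu and a vector e with nu(e) = 1.  Every functional h is
   nu o (e (x) h), a limit of sums of functionals nu o b_i o x_i; as x_i is a
   limit of a sequence of finite-rank operators, all of these lie in the closed
   linear span of one countable set. *)
From HB Require Import structures.
Require Import Defs.
From mathcomp Require Import all_boot all_order all_algebra.
From mathcomp Require Import all_classical all_reals all_analysis.

Set Implicit Arguments.
Unset Strict Implicit.
Unset Printing Implicit Defensive.

Import Order.TTheory GRing.Theory Num.Theory.
Import numFieldNormedType.Exports.

Local Open Scope classical_set_scope.
Local Open Scope ring_scope.

(** * Convergence with explicit rates over an ordered field *)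

Definition vanishing (K : numFieldType) (r : nat -> K) : Prop :=
  forall e, 0 < e -> exists N, forall n, (N <= n)%N -> r n < e.

(** The limit keeps the Cauchy rate [r], so that estimates on approximants carry over to limits with
    explicit constants. *)
Definition rapidly_complete (K : numFieldType) (V : normedModType K) : Prop :=
  forall (u : nat -> V) (r : nat -> K), vanishing r ->
    (forall n m, (n <= m)%N -> `|u n - u m| <= r n) ->
  exists l, forall n, `|u n - l| <= r n.

Lemma vanishing_le (K : numFieldType) (r : nat -> K) (x y : K) :
  vanishing r -> (forall n, x <= y + r n) -> x <= y.
Proof.
move=> r0 xy; apply/ler_addgt0Pr => e /r0[N /(_ N (leqnn N)) rN].
by rewrite (le_trans (xy N))// lerD2l ltW.
Qed.

Lemma vanishing_scale (K : numFieldType) (r : nat -> K) (c : K) :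
  0 <= c -> vanishing r -> vanishing (fun n => c * r n).
Proof.
move=> c0 r0 e e0; have c1 : 0 < c + 1 by rewrite ltr_wpDl.
have [N rN] := r0 (e / (c + 1)) (divr_gt0 e0 c1).
exists N => n /rN {}rN; have [->|cn0] := eqVneq c 0; first by rewrite mul0r.
have cp : 0 < c by rewrite lt_def cn0.
rewrite (lt_trans (_ : _ < c * (e / (c + 1))))//; first by rewrite ltr_pM2l.
by rewrite mulrCA -[ltRHS]mulr1 ltr_pM2l// ltr_pdivrMr// mul1r ltrDl.
Qed.

Lemma complete_rapidly_complete (K : numFieldType) (V : completeNormedModType K) :
  rapidly_complete V.
Proof.
move=> u r r0 ur.
have /cauchy_cvgP uc : cauchy (u n @[n --> \oo]).
  apply/cauchy_exP => e e0; have [N rN] := r0 e e0.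
  exists (u N); exists N => // m /= Nm; rewrite -ball_normE /=.
  exact: le_lt_trans (ur _ _ Nm) (rN _ (leqnn N)).
exists (lim (u n @[n --> \oo])) => n; apply/ler_addgt0Pr => e e0.
have /cvgrPdist_lt/(_ e e0)[N _ uN] := uc.
have := uN (maxn n N) (leq_maxr n N) => /= /ltW ul.
rewrite (le_trans (ler_distD (u (maxn n N)) _ _))// lerD//; last by rewrite distrC.
exact/ur/leq_maxl.
Qed.

(** * Real and complex scalars *)

Section Scalars.
Import complex.

Lemma normc_ge_Im (R : realType) (z : R[i]) : `|Im z|%:C%C <= `|z|.
Proof. by rewrite normc_def lecR -sqrtr_sqr ler_wsqrtr// lerDr sqr_ge0. Qed.

Lemma normc_le_ReIm (R : realType) (z : R[i]) :
  `|z| <= (`|Re z| + `|Im z|)%:C%C.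
Proof.
rewrite normc_def lecR -[leRHS]ger0_norm ?addr_ge0// -sqrtr_sqr.
rewrite ler_wsqrtr// sqrrD !real_normK ?num_real//.
by rewrite lerD2r lerDl mulrn_wge0// mulr_ge0.
Qed.

(** Complex numbers are comparable only if their imaginary parts agree, so positive bounds over
    [R[i]] are real and can be handled in [R]. *)
Lemma ge0_ReK (R : realType) (x : R[i]) : 0 <= x -> (Re x)%:C%C = x.
Proof. by case: x => a b; rewrite lecE/= => /andP[/eqP-> _]. Qed.

(** This is the archimedean property of [R] with n < 2^n; over [R[i]] a positive bound is real. *)
Lemma scalar_vanishing (R : realType) (K : numFieldType) :
  real_or_complex R K -> vanishing (fun n => 2 ^- n : K).
Proof.
have real_vanishing : vanishing (fun n => 2 ^- n : R).
  move=> e e0; exists (Num.Def.archi_bound e^-1) => n en.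
  rewrite invf_plt ?posrE ?exprn_gt0//.
  have /archi_boundP/lt_trans : 0 <= e^-1 by rewrite invr_ge0 ltW.
  apply; rewrite -natrX ltr_nat.
  exact: leq_ltn_trans en (ltn_expl _ _).
case=> // e e0; have ee := ge0_ReK (ltW e0).
have [|N rN] := real_vanishing (Re e); first by rewrite -ltcR ee.
exists N => n /rN; rewrite -ltcR ee; apply: le_lt_trans.
by rewrite fmorphV rmorphXn/= rmorph_nat.
Qed.

Lemma scalar_dense_sequence (R : realType) (K : numFieldType) :
  real_or_complex R K ->
  exists q : nat -> K, forall a e, 0 < e -> exists n, `|a - q n| < e.
Proof.
have real_rat (a e : R) : 0 < e -> exists q, `|a - ratr q| < e.
  move=> e0; have [|q] := @rat_in_itvoo R (a - e) (a + e).
    by rewrite ltrBlDr -addrA ltrDl addr_gt0.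
  by rewrite in_itv/= => qe; exists q; rewrite distrC ltr_distl.
case.
  exists (fun n => odflt 0 (omap ratr (unpickle n : option rat))) => a e.
  by move=> /(real_rat a)[q qe]; exists (pickle q); rewrite pickleK.
exists (fun n => odflt 0 (omap (fun q : rat * rat => (ratr q.1 +i* ratr q.2)%C)
  (unpickle n))) => a e e0.
have ee := ge0_ReK (ltW e0).
have e20 : 0 < Re e / 2 by rewrite divr_gt0// -ltcR ee.
have [q1 aq1] := real_rat (Re a) _ e20; have [q2 aq2] := real_rat (Im a) _ e20.
exists (pickle (q1, q2)); rewrite pickleK/=.
apply: le_lt_trans (normc_le_ReIm _) _; rewrite -ee ltcR.
by rewrite [ltRHS]splitr; case: a aq1 aq2 => a b /=; exact: ltrD.
Qed.

Lemma scalar_rapidly_complete (R : realType) (K : numFieldType) :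
  real_or_complex R K -> rapidly_complete (K^o : normedModType K).
Proof.
have realc : rapidly_complete (R^o : normedModType R).
  exact: (@complete_rapidly_complete R (R^o : completeNormedModType R)).
case=> // u r r0 ur.
have rr n : (Re (r n))%:C%C = r n.
  by apply/ge0_ReK/(le_trans _ (ur n n (leqnn n))).
have Rer0 : vanishing (fun n => Re (r n)).
  move=> e e0; have [|N rN] := r0 e%:C%C; first by rewrite ltcR.
  by exists N => n /rN; rewrite -rr ltcR.
have [a ua] : exists a, forall n, `|Re (u n) - a| <= Re (r n).
  apply: (realc (fun n => Re (u n))) => // n m /ur; rewrite -rr -lecR.
  by apply: le_trans; rewrite -raddfB normc_ge_Re.
have [b ub] : exists b, forall n, `|Im (u n) - b| <= Re (r n).
  apply: (realc (fun n => Im (u n))) => // n m /ur; rewrite -rr -lecR.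
  by apply: le_trans; rewrite -raddfB normc_ge_Im.
have ul n : `|u n - (a +i* b)%C| <= 2 * r n.
  apply: le_trans (normc_le_ReIm _) _; rewrite mulrDl !mul1r -rr -rmorphD/= lecR.
  by case: (u n) (ua n) (ub n) => x y /=; exact: lerD.
(* So far the rate is only [2 * r], one [r] for each coordinate. Comparing [u n] with ever later
   terms, whose distance to the limit vanishes, recovers the rate [r]. *)
exists (a +i* b)%C => n; apply/(@vanishing_le _ (fun m => 2 * r (maxn n m))).
  apply: vanishing_scale => // e /r0[N rN].
  by exists N => m Nm; apply: rN; rewrite (leq_trans Nm)// leq_maxr.
move=> m; rewrite (le_trans (ler_distD (u (maxn n m)) _ _))// lerD//.
exact/ur/leq_maxl.
Qed.

End Scalars.

(** * Bounded operators *)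

Section Operators.
Variable K : numFieldType.
Implicit Types E F G : normedModType K.

HB.instance Definition _ E F (T : bop E F) :=
  GRing.isLinear.Build K E F *:%R T (bopP T).1.

Lemma bop_sumE E F (I : Type) (s : seq I) (P : pred I) (T : I -> bop E F) x :
  (\sum_(i <- s | P i) T i) x = \sum_(i <- s | P i) T i x.
Proof. by elim/big_rec2: _ => // i y U _ <-. Qed.

Lemma bopE E F (S T : bop E F) : (forall x, S x = T x) -> S = T.
Proof. by move=> ST; apply/val_inj/funext. Qed.

Lemma norm_boundD E F (S T : bop E F) c d :
  norm_bound S c -> norm_bound T d -> norm_bound (S + T) (c + d).
Proof.
move=> [c0 Sc] [d0 Td]; split=> [|x]; first exact: addr_ge0.
by rewrite bopDE (le_trans (ler_normD _ _))// mulrDl lerD.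
Qed.

Lemma norm_boundN E F (T : bop E F) c : norm_bound T c -> norm_bound (- T) c.
Proof. by move=> [c0 Tc]; split=> // x; rewrite -[(- T) x]/(- T x) normrN. Qed.

Lemma norm_boundZ E F (a : K) (T : bop E F) c :
  norm_bound T c -> norm_bound (a *: T) (`|a| * c).
Proof.
move=> [c0 Tc]; split=> [|x]; first exact: mulr_ge0.
by rewrite bopZE normrZ -mulrA ler_wpM2l.
Qed.

Lemma norm_bound_comp E F G (S : bop F G) (T : bop E F) c d :
  norm_bound S c -> norm_bound T d -> norm_bound (bop_comp S T) (c * d).
Proof.
move=> [c0 Sc] [d0 Td]; split=> [|x]; first exact: mulr_ge0.
by rewrite (le_trans (Sc _))// -mulrA ler_wpM2l.
Qed.

Lemma norm_bound_le E F (T : bop E F) c d :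
  c <= d -> norm_bound T c -> norm_bound T d.
Proof.
move=> cd [c0 Tc]; split=> [|x]; first exact: le_trans cd.
by rewrite (le_trans (Tc x))// ler_wpM2r.
Qed.

Lemma norm_bound0 E F : norm_bound (0 : bop E F) 0.
Proof. by split=> // x; rewrite mul0r normr0. Qed.

Lemma bop_compBl E F G (S S' : bop F G) (T : bop E F) :
  bop_comp (S - S') T = bop_comp S T - bop_comp S' T.
Proof. exact: bopE. Qed.

Lemma bop_compBr E F G (S : bop F G) (T T' : bop E F) :
  bop_comp S (T - T') = bop_comp S T - bop_comp S T'.
Proof. by apply: bopE => x; exact: linearB. Qed.

Lemma closure_bopP E F (A : set (bop E F)) T :
  closure A T <-> forall e, 0 < e -> exists2 U, A U & norm_bound (T - U) e.
Proof.
split=> [AT e e0|AT B /nbhs_ballP[e /= e0 eB]].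
  have [|U [AU [c Tc ce]]] := AT (ball T e); first exact: nbhsx_ballx.
  by exists U => //; exact: norm_bound_le (ltW ce) Tc.
have [|U AU TU] := AT (e / 2); first by rewrite divr_gt0.
exists U; split=> //; apply: eB; exists (e / 2) => //.
by rewrite ltr_pdivrMr// ltr_pMr// ltr1n.
Qed.

(** A constant factor is harmless; dividing by [C + 1] instead of [C] covers [C = 0]. *)
Lemma closure_bop_scaled E F (A : set (bop E F)) T C : 0 <= C ->
  (forall e, 0 < e -> exists2 U, A U & norm_bound (T - U) (C * e)) -> closure A T.
Proof.
move=> C0 AT; apply/closure_bopP => e e0.
have C1 : 0 < C + 1 by rewrite ltr_wpDl.
have [U AU TU] := AT _ (divr_gt0 e0 C1); exists U => //.
apply: norm_bound_le TU; rewrite mulrCA -[leRHS]mulr1 ler_pM2l//.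
by rewrite ler_pdivrMr// mul1r lerDl.
Qed.

Lemma closure_comp_left E F G (S : bop F G) (A : set (bop E F))
    (B : set (bop E G)) T :
  (forall U, A U -> B (bop_comp S U)) -> closure A T ->
  closure B (bop_comp S T).
Proof.
move=> AB /closure_bopP AT; have [_ [c Sc]] := bopP S.
apply: (closure_bop_scaled Sc.1) => e /AT[U AU TU].
exists (bop_comp S U); first exact: AB.
by rewrite -bop_compBr; exact: norm_bound_comp.
Qed.

Lemma closure_comp_right E F G (S : bop E F) (A : set (bop F G))
    (B : set (bop E G)) T :
  (forall U, A U -> B (bop_comp U S)) -> closure A T ->
  closure B (bop_comp T S).
Proof.
move=> AB /closure_bopP AT; have [_ [c Sc]] := bopP S.
apply: (closure_bop_scaled Sc.1) => e /AT[U AU TU].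
exists (bop_comp U S); first exact: AB.
by rewrite -bop_compBl mulrC; exact: norm_bound_comp.
Qed.

Definition linear_subset (V : lmodType K) (A : set V) : Prop :=
  A 0 /\ forall a x y, A x -> A y -> A (a *: x + y).

Lemma linear_subset_sum (V : lmodType K) (A : set V) (I : Type) (s : seq I)
    (P : pred I) (x : I -> V) : linear_subset A ->
  (forall i, A (x i)) -> A (\sum_(i <- s | P i) x i).
Proof.
move=> [A0 Al] Ax; elim/big_ind: _ => // u v Au Av.
by rewrite -[u]scale1r; exact: Al.
Qed.

Lemma linear_subsetZ (V : lmodType K) (A : set V) a x :
  linear_subset A -> A x -> A (a *: x).
Proof. by move=> [A0 Al] Ax; rewrite -[_ *: _]addr0; exact: Al. Qed.

Lemma closure_linear_subset E F (A : set (bop E F)) :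
  linear_subset A -> linear_subset (closure A).
Proof.
move=> [A0 Al]; split; first exact: subset_closure.
move=> a S T /closure_bopP AS /closure_bopP AT.
have C0 : 0 <= `|a| + 1 by rewrite addr_ge0 ?normr_ge0 ?ler01.
apply: (closure_bop_scaled C0) => e e0.
have [S' AS' SS'] := AS e e0; have [T' AT' TT'] := AT e e0.
exists (a *: S' + T'); first exact: Al.
rewrite opprD addrACA -scalerBr mulrDl mul1r.
by apply: norm_boundD => //; exact: norm_boundZ.
Qed.

Lemma closure_minimal E F (A B : set (bop E F)) :
  closed B -> A `<=` B -> closure A `<=` B.
Proof. by move=> /closure_id {2}-> AB; exact: closure_subset. Qed.

Fact rank_one_subproof E F (v : F) (f : dual E) :
  (fun x => (f x : K) *: v) \in @bounded_linear K E F.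
Proof.
have [_ [c [c0 fc]]] := bopP f; apply/asboolP; split.
  by move=> a x y; rewrite linearP scalerDl scalerA.
exists (c * `|v|); split=> [|x]; first exact: mulr_ge0.
by rewrite normrZ mulrAC ler_wpM2r.
Qed.

Definition rank_one E F (v : F) (f : dual E) : bop E F :=
  Bop (rank_one_subproof v f).

Lemma norm_bound_rank_one E F (v : F) (f : dual E) c :
  norm_bound f c -> norm_bound (rank_one v f) (c * `|v|).
Proof.
move=> [c0 fc]; split=> [|x]; first exact: mulr_ge0.
by rewrite normrZ mulrAC ler_wpM2r.
Qed.

Lemma rank_oneP E F (v : F) a (f g : dual E) :
  rank_one v (a *: f + g) = a *: rank_one v f + rank_one v g.
Proof.
apply: bopE => x.
by rewrite [RHS]bopDE -[LHS]/((a * f x + g x) *: v) scalerDl -scalerA.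
Qed.

Lemma finite_rank_rank_one E F (v : F) (f : dual E) :
  finite_rank (rank_one v f).
Proof.
by exists 1%N, (fun=> v) => x; exists (fun=> f x); rewrite big_ord1.
Qed.

Lemma linear_subset_finite_rank E F : linear_subset (@finite_rank K E F).
Proof.
split.
  by exists 0%N, (fun=> 0) => x; exists (fun=> 0); rewrite big_ord0.
move=> a S T [n [v Sv]] [m [w Tw]].
exists (n + m)%N, (fun i : 'I_(n + m) =>
  match fintype.split i with inl i => v i | inr i => w i end).
move=> x; have [c Sc] := Sv x; have [d Td] := Tw x.
exists (fun i : 'I_(n + m) =>
  match fintype.split i with inl i => a * c i | inr i => d i end).
rewrite bopDE bopZE Sc Td big_split_ord scaler_sumr; congr (_ + _).
  by apply: eq_bigr => i _; rewrite (unsplitK (inl _ i)) scalerA.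
by apply: eq_bigr => i _; rewrite (unsplitK (inr _ i)).
Qed.

Lemma finite_rank_comp_left E F G (S : bop F G) (T : bop E F) :
  finite_rank T -> finite_rank (bop_comp S T).
Proof.
move=> [n [v Tv]]; exists n, (S \o v) => x; have [c Tc] := Tv x.
exists c; rewrite /= Tc linear_sum; apply: eq_bigr => i _.
by rewrite linearZ.
Qed.

Lemma approximable_closed_left_ideal E :
  closed_left_ideal (@approximable K E) (@approximable K E).
Proof.
have [A0 Al] := closure_linear_subset (linear_subset_finite_rank E E).
split; last exact: closed_closure.
split=> // [x y Ax Ay|k x Ax|a x _].
- by rewrite -[x]scale1r; exact: Al.
- by rewrite -[_ *: _]addr0; exact: Al.
- by apply: closure_comp_left => U; exact: finite_rank_comp_left.
Qed.

End Operators.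

(** * Finite-dimensional subspaces and finite-rank operators *)

Section ClosedSubspaces.
Variables (R : realType) (K : numFieldType) (hK : real_or_complex R K).
Implicit Types E F V : normedModType K.

Lemma closure_normP V (A : set V) y :
  closure A y <-> forall e, 0 < e -> exists2 h, A h & `|y - h| < e.
Proof.
split=> [Ay e e0|Ay B /nbhs_ballP[e /= e0 eB]].
  have [|h [Ah]] := Ay (ball y e); first exact: nbhsx_ballx.
  by rewrite -ball_normE; exists h.
have [h Ah yh] := Ay e e0; exists h; split=> //; apply: eB.
by rewrite -ball_normE.
Qed.

Definition span V n (v : 'I_n -> V) : set V :=
  [set y | exists c : 'I_n -> K, y = \sum_(i < n) c i *: v i].

Definition add_line V (H : set V) (v : V) : set V :=
  [set y | exists a h, H h /\ y = a *: v + h].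

Lemma linear_subset_span V n (v : 'I_n -> V) : linear_subset (span v).
Proof.
split; first by exists (fun=> 0); rewrite big1// => i _; rewrite scale0r.
move=> a _ _ [c ->] [d ->]; exists (fun i => a * c i + d i).
rewrite scaler_sumr -big_split; apply: eq_bigr => i _.
by rewrite scalerA scalerDl.
Qed.

Lemma span_recl V n (v : 'I_n.+1 -> V) :
  span v = add_line (span (fun i => v (lift ord0 i))) (v ord0).
Proof.
apply/seteqP; split=> [_ [c ->]|_ [a [_ [[c ->] ->]]]].
  exists (c ord0); exists (\sum_(i < n) c (lift ord0 i) *: v (lift ord0 i)).
  by rewrite big_ord_recl; split=> //; exists (fun i => c (lift ord0 i)).
exists (fun i => oapp c a (unlift ord0 i)).
rewrite big_ord_recl unlift_none/=; congr (_ + _).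
by apply: eq_bigr => i _; rewrite liftK.
Qed.

Lemma add_line_mem V (H : set V) v : linear_subset H -> H v -> add_line H v = H.
Proof.
move=> [H0 Hl] Hv; apply/seteqP; split=> [_ [a [h [Hh ->]]]|h Hh].
  exact: Hl.
by exists 0, h; rewrite scale0r add0r.
Qed.

(** The gap [d] is a lower bound of the distance from [v] to [H], positive because [H] is closed. It
    controls the coefficient of [v] on [add_line H v], which does the work of a Hahn-Banach
    functional. *)
Lemma closed_subspace_gap V (H : set V) v :
  linear_subset H -> closed H -> ~ H v ->
  exists2 d, 0 < d & forall a h, H h -> `|a| * d <= `|a *: v + h|.
Proof.
move=> Hlin /closure_id Hc Hv.
have [d d0 vd] : exists2 d, 0 < d & forall h, H h -> d <= `|v - h|.
  apply: contra_notP Hv => nd; rewrite Hc; apply/closure_normP => e e0.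
  apply: contra_notP nd => ne; exists e => // h Hh.
  rewrite real_leNgt ?normr_real ?gtr0_real//.
  by apply/negP => vh; apply: ne; exists h.
exists d => // a h Hh; have [->|a0] := eqVneq a 0; first by rewrite normr0 mul0r.
have -> : a *: v + h = a *: (v - (- a^-1) *: h).
  by rewrite scalerBr scalerA mulrN divff// scaleN1r opprK.
by rewrite normrZ ler_wpM2l// vd//; exact: linear_subsetZ.
Qed.

(** If a_n v + h_n tends to y, the gap makes (a_n) a Cauchy sequence of scalars; with l its limit, y
    - l v is the limit of the h_n and lies in [H]. *)
Lemma closed_add_line V (H : set V) v :
  linear_subset H -> closed H -> closed (add_line H v).
Proof.
move=> Hlin Hc; have [/add_line_mem ->//|Hv] := pselect (H v).
have [d d0 Hd] := closed_subspace_gap Hlin Hc Hv.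
move=> y /closure_normP Hy.
have /choice[p yp] : forall n, exists p : K * V,
    H p.2 /\ `|y - (p.1 *: v + p.2)| <= 2 ^- n.
  move=> n; have [|_ [a [h [Hh ->]]] /ltW yn] := Hy (2 ^- n).
    by rewrite invr_gt0 exprn_gt0.
  by exists (a, h).
have pow n m : (n <= m)%N -> 2 ^- m <= 2 ^- n :> K.
  by move=> nm; rewrite lef_pV2 ?posrE ?exprn_gt0// ler_eXn2l// ltr1n.
have sv := scalar_vanishing hK.
have dge : 0 <= 2 / d :> K by rewrite divr_ge0// ltW.
(* For n <= m the approximants differ by at most 2^-n + 2^-m <= 2 * 2^-n, and the gap divides this
   by [d]. *)
have [l al] : exists l : K^o, forall n, `|((p n).1 : K^o) - l| <= 2 / d * 2 ^- n.
  apply: (scalar_rapidly_complete hK); first exact: vanishing_scale.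
  move=> n m nm; rewrite mulrAC ler_pdivlMr//.
  have [[Hn yn] [Hm ym]] := (yp n, yp m).
  apply: le_trans (Hd ((p n).1 - (p m).1) ((p n).2 - (p m).2) _) _.
    by rewrite addrC -scaleN1r; exact: Hlin.2.
  have -> : ((p n).1 - (p m).1) *: v + ((p n).2 - (p m).2) =
      (y - ((p m).1 *: v + (p m).2)) - (y - ((p n).1 *: v + (p n).2)).
    by rewrite opprB [RHS]addrC [RHS]addrA subrK scalerBl opprD addrACA.
  rewrite (le_trans (ler_normB _ _))// mulrDl mul1r lerD//.
  exact: le_trans ym (pow _ _ nm).
exists l, (y - l *: v); split; last by rewrite addrC subrK.
rewrite (closure_id H).1//; apply/closure_normP => e e0.
have C0 : 0 <= 1 + 2 / d * `|v| by rewrite addr_ge0 ?ler01// mulr_ge0.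
have [N /(_ N (leqnn N)) N_e] := vanishing_scale C0 sv e0.
exists (p N).2; first exact: (yp N).1.
apply: le_lt_trans N_e.
have -> : y - l *: v - (p N).2 =
    (y - ((p N).1 *: v + (p N).2)) + ((p N).1 - l) *: v.
  by rewrite scalerBl opprD !addrA [y - _ - _ + _]addrAC addrNK addrAC.
rewrite (le_trans (ler_normD _ _))// mulrDl mul1r lerD//; first exact: (yp N).2.
by rewrite normrZ mulrAC ler_wpM2r//; exact: al.
Qed.

Lemma closed_span V n (v : 'I_n -> V) : closed (span v).
Proof.
elim: n v => [|n IHn] v; last first.
  by rewrite span_recl; apply: closed_add_line => //; exact: linear_subset_span.
move=> y /closure_normP y0; exists (fun=> 0); rewrite big_ord0.
apply/eqP; rewrite -normr_le0; apply/ler_addgt0Pr => e /y0[_ [c ->]].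
by rewrite big_ord0 subr0 add0r => /ltW.
Qed.

(** By induction on n: modulo the span of the other vectors, the coefficient of [v ord0] in [T x] is
    a functional of x, bounded by the gap. Subtracting its rank-one operator leaves a map into the
    smaller span. The vectors may be dependent. *)
Lemma finite_rank_decomposition E F (T : bop E F) n (v : 'I_n -> F) :
  (forall x, span v (T x)) ->
  exists f : 'I_n -> dual E, T = \sum_(i < n) rank_one (v i) (f i).
Proof.
elim: n v T => [|n IHn] v T Tv.
  exists (fun=> 0); apply: bopE => x; rewrite bop_sumE.
  by have [c ->] := Tv x; rewrite !big_ord0.
pose w i := v (lift ord0 i).
suff [f0 Tf0] : exists f0 : dual E, forall x, span w ((T - rank_one (v ord0) f0) x).
  have [f Tf] := IHn _ _ Tf0; exists (fun i => oapp f f0 (unlift ord0 i)).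
  rewrite big_ord_recl unlift_none/=; under eq_bigr do rewrite liftK/=.
  by rewrite -Tf addrC subrK.
have wlin := linear_subset_span w.
have [wv0|wv0] := pselect (span w (v ord0)).
  exists 0 => x; rewrite bopBE -[rank_one _ _ _]/(0 *: v ord0) scale0r subr0.
  by have := Tv x; rewrite span_recl add_line_mem.
have [d d0 wd] := closed_subspace_gap wlin (@closed_span _ _ w) wv0.
have /choice[a Ta] : forall x, exists a, span w (T x - a *: v ord0).
  move=> x; have := Tv x; rewrite span_recl => -[a [h [wh ->]]].
  by exists a; rewrite addrC addKr.
have a_le b x : span w (T x - b *: v ord0) -> `|b| * d <= `|T x|.
  by move=> /(wd b); rewrite addrC subrK.
have alin : linear (a : E -> K^o).
  move=> k x y; apply/eqP; rewrite -subr_eq0 -normr_le0.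
  rewrite -(ler_pM2r d0) mul0r -(normr0 F).
  (* The defect b of linearity satisfies T 0 - b v_0 in the span of [w], so [a_le] at 0 gives |b| d
     <= |T 0| = 0. *)
  have -> : 0 = T 0 by rewrite linear0.
  apply: a_le; rewrite linear0 sub0r -scaleNr opprB.
  have := wlin.2 (-1) _ _ (wlin.2 k _ _ (Ta x) (Ta y)) (Ta (k *: x + y)).
  rewrite (linearP T) scalerBr addrACA -opprD scaleN1r opprB addrA subrK.
  by rewrite scalerA -scalerDl -scalerBl.
have abd : (a : E -> K^o) \in @bounded_linear K E K^o.
  apply/asboolP; split=> //; have [_ [c [c0 Tc]]] := bopP T.
  exists (c / d); split=> [|x]; first by rewrite divr_ge0// ltW.
  rewrite mulrAC ler_pdivlMr//; exact: le_trans (a_le _ _ (Ta x)) (Tc x).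
by exists (Bop abd) => x; exact: Ta.
Qed.

End ClosedSubspaces.

(** Course-of-values recursion, as Gram-Schmidt requires: [prefix n] turns out to be [mkseq s n],
    the list of all earlier terms. *)
Lemma strong_recursion (X : Type) (step : seq X -> X) :
  exists s : nat -> X, forall n, s n = step (mkseq s n).
Proof.
pose prefix n := iteri n (fun _ s => rcons s (step s)) [::].
exists (fun n => step (prefix n)) => n; congr step.
by elim: n => // n IHn; rewrite mkseqS -IHn.
Qed.

Lemma sum_mkseq (V : nmodType) (X : Type) (h : X -> V) (s : nat -> X) n :
  \sum_(p <- mkseq s n) h p = \sum_(i < n) h (s i).
Proof.
by rewrite big_map -(big_mkord xpredT (fun i => h (s i))) /index_iota subn0.
Qed.

(** * Series of operators and biorthogonal systems *)

Section Sequences.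
Variables (R : realType) (K : numFieldType) (hK : real_or_complex R K).
Implicit Types E F : normedModType K.

(** The pointwise limit is linear and bounded; as the rate at x is [r n] times the norm of x, it is
    also the limit in operator norm. *)
Lemma rapidly_cauchy_bop E F (u : nat -> bop E F) (r : nat -> K) :
  rapidly_complete F -> vanishing r ->
  (forall n m, (n <= m)%N -> norm_bound (u n - u m) (r n)) ->
  exists T, forall n, norm_bound (u n - T) (r n).
Proof.
move=> Fc r0 ur.
have rge0 n : 0 <= r n by have [] := ur n n (leqnn n).
have /choice[T uT] : forall x, exists l, forall n, `|u n x - l| <= r n * `|x|.
  move=> x; apply: (Fc (fun n => u n x) (fun n => r n * `|x|)).
    move=> e /(vanishing_scale (normr_ge0 x) r0)[N rN].
    by exists N => n /rN; rewrite mulrC.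
  by move=> n m /ur[_ /(_ x)].
have Tlin : linear T.
  move=> a x y; apply/eqP; rewrite -subr_eq0 -normr_le0.
  (* Since [u n] is linear, the defect of linearity of [T] combines the errors of [u n] at x, y and
     a x + y. *)
  apply: (@vanishing_le _ (fun n => (`|a *: x + y| + (`|a| * `|x| + `|y|)) * r n)).
    by apply: vanishing_scale; rewrite ?addr_ge0 ?mulr_ge0.
  move=> n; rewrite add0r.
  have -> : T (a *: x + y) - (a *: T x + T y) =
      (a *: (u n x - T x) + (u n y - T y)) - (u n (a *: x + y) - T (a *: x + y)).
    rewrite (linearP (u n)) scalerBr addrACA -opprD opprB.
    by rewrite [RHS]addrC [RHS]addrA subrK.
  rewrite (le_trans (ler_normB _ _))// addrC mulrDl lerD//; first by rewrite mulrC.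
  rewrite (le_trans (ler_normD _ _))// mulrDl lerD//; last by rewrite mulrC.
  by rewrite normrZ -mulrA ler_wpM2l// mulrC.
have Tbd : T \in @bounded_linear K E F.
  apply/asboolP; split=> //; have [_ [c [c0 uc]]] := bopP (u 0%N).
  exists (c + r 0%N); split=> [|x]; first by rewrite addr_ge0.
  have -> : T x = u 0%N x - (u 0%N x - T x) by rewrite opprB addrC subrK.
  by rewrite (le_trans (ler_normB _ _))// mulrDl lerD.
by exists (Bop Tbd) => n; split=> // x; exact: uT.
Qed.

Lemma norm_bound_geometric_tail E F (u : nat -> bop E F) :
  (forall k, norm_bound (u k) (2 ^- k)) -> forall n m, (n <= m)%N ->
  norm_bound (\sum_(k < n) u k - \sum_(k < m) u k) (2 * 2 ^- n).
Proof.
move=> uk n m nm.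
(* The exact geometric sum is a bound that an induction on m can carry. *)
suff : norm_bound (\sum_(k < n) u k - \sum_(k < m) u k) (2 * 2 ^- n - 2 * 2 ^- m).
  apply: norm_bound_le; rewrite lerBlDr lerDl mulr_ge0// invr_ge0 exprn_ge0//.
rewrite -(subnKC nm); elim: {m nm}(m - n)%N => [|p IHp].
  by rewrite addn0 !subrr; exact: norm_bound0.
rewrite addnS big_ord_recr/= opprD addrA.
have -> : 2 * 2 ^- n - 2 * 2 ^- (n + p).+1 =
    2 * 2 ^- n - 2 * 2 ^- (n + p) + 2 ^- (n + p) :> K.
  rewrite exprS invfM mulrA divff ?pnatr_eq0// mul1r -addrA; congr (_ + _).
  by rewrite mulrDl mul1r opprD addrNK.
exact: norm_boundD IHp (norm_boundN (uk _)).
Qed.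

Lemma geometric_series E F (u : nat -> bop E F) :
  rapidly_complete F -> (forall k, norm_bound (u k) (2 ^- k)) ->
  exists T, forall n, norm_bound (\sum_(k < n) u k - T) (2 * 2 ^- n).
Proof.
move=> Fc uk; apply: rapidly_cauchy_bop Fc _ (norm_bound_geometric_tail uk).
exact: vanishing_scale (scalar_vanishing hK).
Qed.

Lemma functionalZ E (g : dual E) (a : K) x : g (a *: x) = a * (g x : K) :> K.
Proof. by rewrite linearZ. Qed.

Lemma functional_eq0_or_normalised E (g : dual E) : g = 0 \/ exists x, g x = 1.
Proof.
have [->|g0] := eqVneq g 0; [by left|right].
have [y gy] : exists y, g y != 0.
  apply: contra_neqP g0 => ng; apply: bopE => y; apply/eqP.
  by apply: contra_notT ng => gy; exists y.
by exists ((g y : K)^-1 *: y); rewrite functionalZ mulVf.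
Qed.

(** Gram-Schmidt on both sides: g_n is f_n minus its expansion in the earlier g_i, hence kills the
    earlier x_i. A vector on which g_n is 1 is then corrected by the earlier x_i, which leaves the
    value of g_n unchanged. If f_n depends on the earlier functionals, g_n is 0. *)
Lemma biorthogonal_sequence E (f : nat -> dual E) :
  exists (x : nat -> E) (g : nat -> dual E),
  [/\ forall n, f n = g n + \sum_(i < n) (f n (x i) : K) *: g i,
      forall m n, m != n -> g m (x n) = 0 &
      forall n, g n = 0 \/ g n (x n) = 1].
Proof.
(* The zero functional gets the vector 0, so that x_j = 0 whenever g_j = 0; later functionals then
   vanish at x_j trivially. *)
have /choice[w gw] : forall g : dual E, exists x, (g = 0 /\ x = 0) \/ g x = 1.
  move=> g; have [->|[y gy]] := functional_eq0_or_normalised g.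
    by exists 0; left.
  by exists y; right.
pose red (s : seq (E * dual E)) (h : dual E) : dual E :=
  h - \sum_(p <- s) (h p.1 : K) *: p.2.
pose step s := let g := red s (f (size s)) in
  (w g - \sum_(p <- s) (p.2 (w g) : K) *: p.1, g).
have [s sE] := strong_recursion step.
pose x n := (s n).1; pose g n := (s n).2.
have gE n : g n = f n - \sum_(i < n) (f n (x i) : K) *: g i.
  by rewrite {1}/g sE /= /red size_mkseq sum_mkseq.
have xE n : x n = w (g n) - \sum_(i < n) (g i (w (g n)) : K) *: x i.
  have -> : x n = w (g n) - \sum_(p <- mkseq s n) (p.2 (w (g n)) : K) *: p.1.
    by rewrite /x /g !sE.
  by rewrite sum_mkseq.
pose P n := forall i j, (i < n)%N -> (j < n)%N ->
  (i != j -> g i (x j) = 0) /\ (g i = 0 /\ x i = 0 \/ g i (x i) = 1).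
have PT n : P n.
  elim: n => // n IHn.
  have gn j : (j < n)%N -> g n (x j) = 0.
    move=> jn; rewrite gE bopBE bop_sumE (bigD1 (Ordinal jn))//.
    rewrite big1 => [|i ij]; rewrite bopZE/=.
      have [_ [[-> ->]|gj]] := IHn j j jn jn.
        by rewrite !linear0 addr0; exact: subrr.
      by rewrite gj addr0 [_ *: _]mulr1 subrr.
    by rewrite (IHn i j (ltn_ord i) jn).1// scaler0.
  have xn i : (i < n)%N -> g i (x n) = 0.
    move=> lt_in; rewrite xE linearB linear_sum (bigD1 (Ordinal lt_in))//=.
    rewrite big1 => [|j ji].
      rewrite functionalZ addr0; have [_ [[-> _]|->]] := IHn i i lt_in lt_in.
        by rewrite mulr0; exact: subrr.
      by rewrite mulr1 subrr.
    by rewrite functionalZ (IHn i j lt_in (ltn_ord j)).1 ?mulr0// eq_sym.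
  have gx : g n = 0 /\ x n = 0 \/ g n (x n) = 1.
    have [[gn0 w0]|gw1] := gw (g n); [left|right].
      split=> //; rewrite xE w0 sub0r big1 ?oppr0// => i _.
      by rewrite linear0 scale0r.
    rewrite xE linearB linear_sum/= gw1 big1 ?subr0// => i _.
    by rewrite functionalZ gn ?mulr0.
  move=> i j; rewrite !ltnS leq_eqVlt => /predU1P[->|lt_in];
    rewrite leq_eqVlt => /predU1P[->|jn]; split=> //; first by rewrite eqxx.
  - by move=> _; exact: gn.
  - by move=> _; exact: xn.
  - by have [_] := IHn i i lt_in lt_in.
  - exact: (IHn i j lt_in jn).1.
  - exact: (IHn i j lt_in jn).2.
exists x, g; split=> [n|m n mn|n].
- by rewrite [X in X + _]gE subrK.
- exact: (PT (maxn m n).+1 m n (leq_maxl m n) (leq_maxr m n)).1.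
- by have [_ [[]|]] := PT n.+1 n n (leqnn _) (leqnn _); [left|right].
Qed.

End Sequences.

(** * Closed left ideals and their row spaces *)

Section LeftIdeals.
Variables (R : realType) (K : numFieldType) (hK : real_or_complex R K).
Variable E : completeNormedModType K.
Implicit Types (I : set (bop E E)) (T : bop E E) (f g : dual E).
Local Notation A := (@approximable K E).

(** The operator norm separates points; this lets an identity between operators pass to a limit. *)
Lemma closure_set1 (F G : normedModType K) (S T : bop F G) :
  closure [set S] T -> T = S.
Proof.
move=> /closure_bopP ST; apply: bopE => x; apply/eqP.
rewrite -subr_eq0 -normr_le0.
apply: (@vanishing_le _ (fun n => `|x| * 2 ^- n)).
  exact/vanishing_scale/(scalar_vanishing hK).
move=> n; have [|_ -> [_ Tn]] := ST (2 ^- n); first by rewrite invr_gt0 exprn_gt0.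
by rewrite add0r mulrC; exact: Tn.
Qed.

(** For each point d of a countable dense set and each n, an element of [F] within 2^-n of d is
    chosen if there is one. The map [j] numbers the points d, and the default 0 lies in [F]. *)
Lemma separable_subset_sequence (F : set (dual E)) :
  separable_space (dual E) -> F 0 ->
  exists f : nat -> dual E, (forall n, F (f n)) /\ F `<=` closure (range f).
Proof.
move=> [D [/countable_injP[j jinj] Dd]] F0.
pose P (p : nat * nat) g :=
  F g /\ exists2 d, D d /\ j d = p.1 & norm_bound (d - g) (2 ^- p.2).
pose s n := xget 0 (fun g => exists2 p, unpickle n = Some p & P p g).
exists s; split=> [n|f Ff].
  by rewrite /s; case: xgetP => [g _ [p _ []]|].
have C0 : 0 <= 2 :> K by rewrite ler0n.
apply: (closure_bop_scaled C0) => e e0.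
have [n /(_ n (leqnn n)) ne] := scalar_vanishing hK e0.
have n0 : 0 < 2 ^- n :> K by rewrite invr_gt0 exprn_gt0.
have [d [fd Dd']] : (ball f (2 ^- n))° `&` D !=set0.
  by apply: Dd; [exists f; exact: nbhsx_ballx|exact: open_interior].
have {fd}[c fc cn] := interior_subset fd.
have fdn : norm_bound (f - d) (2 ^- n) by exact: norm_bound_le (ltW cn) fc.
have Pf : P (j d, n) f.
  by split=> //; exists d => //; rewrite -opprB; exact: norm_boundN.
have [p] : exists2 p,
    unpickle (pickle (j d, n)) = Some p & P p (s (pickle (j d, n))).
  have : exists g, exists2 p, unpickle (pickle (j d, n)) = Some p & P p g.
    by exists f, (j d, n); rewrite ?pickleK.
  by move=> /(xgetPex 0).
rewrite pickleK => -[<-] [_ [d' [Dd'' /jinj dd']] /= d's].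
exists (s (pickle (j d, n))); first by exists (pickle (j d, n)).
have {}d's : norm_bound (d - s (pickle (j d, n))) (2 ^- n).
  by rewrite -[d in d - _]dd' ?inE.
rewrite -(subrK d f) -addrA; apply: norm_bound_le (norm_boundD fdn d's).
by rewrite mulrDl mul1r lerD// ltW.
Qed.

Definition row_space I : set (dual E) := [set f | forall v, I (rank_one v f)].

Lemma row_space_linear I : linear_subset I -> linear_subset (row_space I).
Proof.
move=> Ilin; split=> [v|a f g If Ig v]; last by rewrite rank_oneP; exact: Ilin.2.
rewrite (_ : rank_one v 0 = 0); first exact: Ilin.1.
by apply: bopE => x; exact: scale0r.
Qed.

Lemma row_space_closed I : closed I -> closure (row_space I) `<=` row_space I.
Proof.
move=> /closure_id Ic f /closure_bopP If v; rewrite Ic.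
apply: (closure_bop_scaled (normr_ge0 v)) => e /If[g Ig fg].
exists (rank_one v g) => //; rewrite mulrC.
rewrite (_ : _ - _ = rank_one v (f - g)); first exact: norm_bound_rank_one.
by rewrite -scaleN1r addrC -rank_oneP scaleN1r addrC.
Qed.

Lemma left_ideal_linear I : left_ideal A I -> linear_subset I.
Proof. by move=> [_ I0 ID IZ _]; split=> // a x y Ix Iy; exact/ID/Iy/IZ. Qed.

Lemma approximable_rank_one (v : E) f : A (rank_one v f).
Proof. exact/subset_closure/finite_rank_rank_one. Qed.

Lemma rank_one_mul (v : E) f T : rank_one v f * T = rank_one v (bop_comp f T).
Proof. exact: bopE. Qed.

Lemma row_space_comp I f T : left_ideal A I -> I T -> row_space I (bop_comp f T).
Proof.
move=> [_ _ _ _ IM] IT v; rewrite -rank_one_mul.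
by apply: IM => //; exact: approximable_rank_one.
Qed.

(** The approximate identity puts T in the closure of A T; right multiplication by T is continuous,
    and A is the closure of the finite-rank operators. *)
Lemma left_approximate_identity_closure T :
  has_left_approximate_identity A -> A T ->
  closure [set S * T | S in @finite_rank K E E] T.
Proof.
move=> [D [le [u [[_ refl _ _] Au uT]]]] AT.
suff : closure [set S * T | S in A] T.
  apply: closure_minimal; first exact: closed_closure.
  move=> _ [S AS <-]; apply: (closure_comp_right (A := @finite_rank K E E)) AS.
  by move=> U fU; exists U.
apply/closure_bopP => e e0.
have [|d _ /(_ d (refl d)) [c Tc ce]] := uT T AT (ball T e).
  exact: nbhsx_ballx.
by exists (u d * T); [exists (u d)|exact: norm_bound_le (ltW ce) Tc].
Qed.

Lemma row_space_generates I (J : set (bop E E)) :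
  has_left_approximate_identity A -> left_ideal A I ->
  linear_subset J -> closed J ->
  (forall f, row_space I f -> forall v, J (rank_one v f)) -> I `<=` J.
Proof.
move=> lai Iid Jlin Jc IJ T IT; have [IA _ _ _ _] := Iid.
apply: closure_minimal Jc _ _ (left_approximate_identity_closure lai (IA _ IT)).
move=> _ [S [n [v Sv]] <-].
have [f ->] := finite_rank_decomposition hK Sv.
(* S T is the sum of the v_i (x) (f_i T), and f_i T lies in the row space because T lies in I. *)
rewrite mulr_suml; apply: linear_subset_sum => // i.
by rewrite rank_one_mul; apply: IJ; exact: row_space_comp.
Qed.

Lemma unitisation_linear : linear_subset (unitisation A).
Proof.
have [/left_ideal_linear [A0 Al] _] := approximable_closed_left_ideal E.
split; first by left.
move=> a x y [Ax|[nA [x' [k [Ax' ->]]]]] [Ay|[nA' [y' [l [Ay' ->]]]]].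
- by left; exact: Al.
- by right; split=> //; exists (a *: x + y'), l; rewrite addrA; split=> //; exact: Al.
- right; split=> //; exists (a *: x' + y), (a * k).
  by rewrite scalerDr scalerA addrAC; split=> //; exact: Al.
- right; split=> //; exists (a *: x' + y'), (a * k + l); split; first exact: Al.
  by rewrite scalerDr scalerA addrACA scalerDl.
Qed.

Lemma principal_linear T : linear_subset [set b * T | b in unitisation A].
Proof.
have [U0 Ul] := unitisation_linear; split; first by exists 0; rewrite ?mul0r.
move=> a _ _ [b Ub <-] [c Uc <-]; exists (a *: b + c); first exact: Ul.
exact: bopE.
Qed.

Lemma principal_sub I T : left_ideal A I -> I T ->
  [set b * T | b in unitisation A] `<=` I.
Proof.
move=> Iid IT; have [IA I0 ID IZ IM] := Iid.
move=> _ [b [Ab|[_ [a [k [Aa ->]]]]] <-]; first exact: IM.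
rewrite mulrDl; apply: ID; first exact: IM.
by rewrite (_ : _ * _ = k *: T); [exact: IZ|exact: bopE].
Qed.

Lemma separable_dual_principal I :
  has_left_approximate_identity A -> separable_space (dual E) ->
  closed_left_ideal A I -> topologically_principal A I.
Proof.
move=> lai sep [Iid Ic].
have Ilin := left_ideal_linear Iid; have Flin := row_space_linear Ilin.
have [f [If fI]] := separable_subset_sequence sep Flin.1.
have [x [g [fE gx0 gx1]]] := biorthogonal_sequence f.
(* Solving [fE] for g_n keeps it in the row space, by strong induction. *)
have Ig n : row_space I (g n).
  elim/ltn_ind: n => n IHn.
  rewrite -[g n](addrK (\sum_(i < n) (f n (x i) : K) *: g i)) -fE.
  rewrite addrC -scaleN1r; apply: Flin.2 => //.
  apply: (linear_subset_sum _ _ Flin) => i.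
  by apply: (linear_subsetZ _ Flin); exact: IHn.
have /choice[b gb] n : exists b, norm_bound (rank_one (x n) (g n)) b.
  exact: (bopP _).2.
have b1 n : 0 < b n + 1 by have [b0 _] := gb n; rewrite ltr_wpDl.
(* This weight makes the n-th term at most 2^-n in norm; the 1 keeps the divisor positive when [b n]
   is 0. *)
pose c n := 2 ^- n / (b n + 1).
have c0 n : 0 < c n by rewrite divr_gt0// invr_gt0 exprn_gt0.
have [|T ST] := @geometric_series _ _ hK E E (fun n => c n *: rank_one (x n) (g n))
    (@complete_rapidly_complete K E).
  move=> k; apply: norm_bound_le (norm_boundZ (c k) (gb k)).
  by rewrite gtr0_norm// mulrAC ler_pdivrMr// ler_wpM2l ?lerDl ?ler01//.
(* T is the limit of the partial sums, so a closed set containing those of length above m contains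
   T. All such sums include the m-th term. *)
have closure_tail m (B : set (bop E E)) : closed B ->
    (forall n, (m < n)%N -> B (\sum_(k < n) c k *: rank_one (x k) (g k))) -> B T.
  move=> Bc Bn; apply: Bc; apply/closure_bopP => e e0.
  have [N eN] := vanishing_scale (ler0n _ 2) (scalar_vanishing hK) e0.
  exists (\sum_(k < maxn N m.+1) c k *: rank_one (x k) (g k)).
    by apply: Bn; exact: leq_maxr.
  rewrite -opprB; apply: norm_boundN; have := ST (maxn N m.+1); apply: norm_bound_le.
  by apply/ltW/eN; exact: leq_maxl.
have IT : I T.
  apply: (closure_tail 0%N) => // n _; apply: linear_subset_sum => // k.
  by apply: linear_subsetZ => //; exact: Ig.
exists T => //; apply/seteqP; split; last first.
  by apply: closure_minimal => //; exact: principal_sub.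
pose J := closure [set b * T | b in unitisation A].
have Jlin : linear_subset J by exact/closure_linear_subset/principal_linear.
have Jc : closed J by exact: closed_closure.
(* For partial sums of length above m this is biorthogonality, both sides being 0 if g_m = 0; the
   identity then passes to the limit T. *)
have gT m : bop_comp (g m) T = c m *: g m.
  have := closure_tail m [set S | bop_comp (g m) S = c m *: g m]; apply.
    move=> S BS; apply: closure_set1.
    by apply: (closure_comp_left _ BS) => U.
  move=> n mn; apply: bopE => y; rewrite -[LHS]/(g m _) bop_sumE linear_sum.
  rewrite (bigD1 (Ordinal mn))//= big1 ?addr0 => [|k km].
    rewrite 2!functionalZ.
    have [->|->] := gx1 m; last by rewrite mulr1.
    exact: congr1 (mulr0 0).
  by rewrite 2!functionalZ gx0 ?mulr0// eq_sym.
(* Dividing by c_m exhibits v (x) g_m as a left multiple of T. *)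
have Jg m v : J (rank_one v (g m)).
  rewrite -[rank_one _ _]scale1r -(mulVf (lt0r_neq0 (c0 m))) -scalerA.
  apply: (linear_subsetZ _ Jlin); apply: subset_closure.
  exists (rank_one v (g m)); first by left; exact: approximable_rank_one.
  rewrite rank_one_mul gT -[c m *: g m]addr0 rank_oneP.
  by rewrite (_ : rank_one v 0 = 0) ?addr0//; apply: bopE => y; exact: scale0r.
apply: row_space_generates => // h Ih.
have Rlin := row_space_linear Jlin.
(* The f_n are dense in the row space of I, and the row space of J is closed. *)
suff fJ : range f `<=` row_space J.
  exact/(row_space_closed Jc)/(closureS fJ)/fI.
move=> _ [n _ <-]; rewrite fE -[g n]scale1r; apply: Rlin.2 => [v|]; first exact: Jg.
apply: (linear_subset_sum _ _ Rlin) => i.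
by apply: (linear_subsetZ _ Rlin) => v; exact: Jg.
Qed.

End LeftIdeals.

(** * Separability of the dual *)

Section Separability.
Variables (R : realType) (K : numFieldType) (hK : real_or_complex R K).
Implicit Types E F : normedModType K.

(** D consists of the finite combinations with coefficients in a dense sequence of scalars; it is
    countable because finite lists over a countable type are. *)
Lemma countable_linear_hull E F (J : countType) (u : J -> bop E F) :
  exists D : set (bop E F),
    [/\ countable D, linear_subset (closure D) & forall j, closure D (u j)].
Proof.
have [q qdense] := scalar_dense_sequence hK.
pose comb (s : seq (nat * J)) := \sum_(p <- s) q p.1 *: u p.2.
pose D := range comb.
have Du a j : closure D (a *: u j).
  have [_ [c uc]] := bopP (u j).
  apply: (closure_bop_scaled uc.1) => e /(qdense a)[n qn].
  exists (comb [:: (n, j)]); first by exists [:: (n, j)].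
  rewrite /comb big_seq1 -scalerBl mulrC.
  by apply: norm_bound_le (norm_boundZ _ uc); rewrite ler_wpM2r ?uc.1// ltW.
have DD S T : closure D S -> closure D T -> closure D (S + T).
  move=> /closure_bopP DS /closure_bopP DT; apply: (closure_bop_scaled (ler0n _ 2)).
  move=> e e0; have [_ [s _ <-] Ss] := DS e e0; have [_ [t _ <-] Tt] := DT e e0.
  exists (comb (s ++ t)); first by exists (s ++ t).
  by rewrite /comb big_cat opprD addrACA mulrDl mul1r; exact: norm_boundD.
have D0 : closure D 0.
  by apply: subset_closure; exists [::]; rewrite // /comb big_nil.
(* As a is an arbitrary scalar, a multiple of an element of D lies only in the closure of D; hence
   the detour through the closure of that closure. *)
have DZ a T : closure D T -> closure D (a *: T).
  move=> /closure_bopP DT; apply: closure_minimal (@closed_closure _ D) _ _ _.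
    exact: subset_refl.
  apply: (closure_bop_scaled (normr_ge0 a)) => e /DT[_ [s _ <-] Ts].
  exists (a *: comb s); last by rewrite -scalerBr; exact: norm_boundZ.
  rewrite scaler_sumr; elim/big_ind: _ => // p _; rewrite scalerA; exact: Du.
exists D; split=> [||j]; last by rewrite -[u j]scale1r; exact: Du.
  exact: sub_countable (card_image_le _ _) (countableP _).
by split=> // a x y Dx Dy; apply: DD => //; exact: DZ.
Qed.

(** With S the sum of the v_i (x) f_i, the functional g S is the sum of the g(v_i) f_i. Quantifying
    over [L] expresses membership in the linear span of the f_i. *)
Lemma finite_rank_functionals E F (S : bop E F) : finite_rank S ->
  exists f : nat -> dual E, forall L : set (dual E), linear_subset L ->
    (forall n, L (f n)) -> forall g : dual F, L (bop_comp g S).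
Proof.
move=> [n [v Sv]]; have [f ->] := finite_rank_decomposition hK Sv.
(* Padding the finite family with 0 gives all operators S the same index type. *)
exists (fun k => oapp f 0 (insub k)) => L Llin Lf g.
rewrite (_ : bop_comp _ _ = \sum_(i < n) (g (v i) : K) *: f i).
  apply: (linear_subset_sum _ _ Llin) => i; apply: (linear_subsetZ _ Llin).
  by have := Lf i; rewrite valK.
apply: bopE => x; rewrite -[LHS]/(g _) !bop_sumE linear_sum.
apply: eq_bigr => i _.
by rewrite -[LHS]/(g ((f i x : K) *: v i)) functionalZ mulrC.
Qed.

Lemma finitely_generated_dual_separable E :
  topologically_finitely_generated (@approximable K E) (@approximable K E) ->
  separable_space (dual E).
Proof.
move=> [n [x [Ax AE]]].
(* Without such a pair every functional is 0, and the dual is a single point. *)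
have [[nu [e nue]]|E'0] := pselect (exists (nu : dual E) e, nu e = 1); last first.
  exists [set 0]; split; first exact: countable1.
  move=> O [h Oh] _; exists h; split=> //.
  have [//|[e he]] := functional_eq0_or_normalised h.
  by case: E'0; exists h, e.
have /choice[S xS] (p : 'I_n * nat) :
    exists T, finite_rank T /\ norm_bound (x p.1 - T) (2 ^- p.2).
  have /closure_bopP/(_ (2 ^- p.2))[|T fT xT] := Ax p.1; last by exists T.
  by rewrite invr_gt0 exprn_gt0.
have /choice[f Sf] p := finite_rank_functionals (xS p).1.
have [D [Dc Dlin Df]] :=
  countable_linear_hull (fun j : ('I_n * nat) * nat => f j.1 j.2).
have DS p (g : dual E) : closure D (bop_comp g (S p)).
  by apply: Sf => // k; exact: (Df (p, k)).
have Dx i (g : dual E) : closure D (bop_comp g (x i)).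
  (* As [closure D] is its own closure, it is enough that x_i is a limit of the S (i, k), to which
     [DS] applies. *)
  rewrite (closure_id (closure D)).1; last exact: closed_closure.
  apply: (closure_comp_left (A := range (fun k => S (i, k)))) => [_ [k _ <-]//|].
  apply/closure_bopP => r /(scalar_vanishing hK)[N /(_ N (leqnn N)) rN].
  exists (S (i, N)); first by exists N.
  by apply: norm_bound_le (ltW rN) (xS (i, N)).2.
exists D; split=> // O [h Oh] Oo; rewrite setIC.
suff : closure D h by apply; exact: open_nbhs_nbhs.
have -> : h = bop_comp nu (rank_one e h).
  by apply: bopE => y; rewrite -[RHS]/(nu _) functionalZ nue mulr1.
have : closure (generated (@approximable K E) x) (rank_one e h).
  by rewrite -AE; exact/subset_closure/finite_rank_rank_one.
rewrite (closure_id (closure D)).1; last exact: closed_closure.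
apply: closure_comp_left => _ [b _ ->].
(* Each nu b_i is again a bounded functional, so [Dx] applies to it for every b_i in the
   unitisation. *)
rewrite (_ : bop_comp _ _ = \sum_(i < n) bop_comp (bop_comp nu (b i)) (x i)).
  by apply: (linear_subset_sum _ _ Dlin) => i; exact: Dx.
apply: bopE => y; rewrite -[LHS]/(nu _) !bop_sumE linear_sum.
exact: eq_bigr.
Qed.

End Separability.

(** * The cycle of implications between (a), (b) and (c) *)

Theorem theorem4p5 (R : realType) (K : numFieldType)
    (hK : real_or_complex R K) (E : completeNormedModType K)
    (hE : has_left_approximate_identity (@approximable K E)) :
  [<-> topologically_left_noetherian (@approximable K E);
       forall I : set (bop E E), closed_left_ideal (@approximable K E) I ->
         topologically_principal (@approximable K E) I;
       separable_space (dual E)].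
Proof.
have ac : topologically_left_noetherian (@approximable K E) ->
    separable_space (dual E).
  move=> /(_ _ (approximable_closed_left_ideal E)).
  exact: (finitely_generated_dual_separable hK).
have cb : separable_space (dual E) -> forall I : set (bop E E),
    closed_left_ideal (@approximable K E) I ->
    topologically_principal (@approximable K E) I.
  by move=> sep I; exact: (separable_dual_principal hK).
have ba : (forall I : set (bop E E), closed_left_ideal (@approximable K E) I ->
    topologically_principal (@approximable K E) I) ->
    topologically_left_noetherian (@approximable K E).
  move=> bI I /bI[x Ix IE]; exists 1%N, (fun=> x); split=> //.
  rewrite {1}IE; congr closure; apply/seteqP; split=> [_ [b Ub <-]|_ [b Ub ->]].
    by exists (fun=> b); rewrite ?big_ord1.
  by exists (b ord0); rewrite ?big_ord1.
by tfae; [move=> /ac/cb|move=> /ba/ac|move=> /cb/ba].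
Qed.
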